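(* Let $F_t(z)=z-tH(z)\in\mathbb E_t^{[\alpha]}\langle\langle z\rangle\rangle$ with inverse map $G_t(z)=z+tN_t(z)$, $N_t(z)=\sum_{m\ge1}t^{m-1}N_{[m]}(z)$. For any $m\ge1$, $$N_{[m]}(z)=\sum_{I\in\mathcal C_m}\frac1{\pi_u(I)}\,\psi^Iz,$$ where, for $k\ge1$, $\psi_k=[C_k(z)\frac{\partial}{\partial z}]$ in general, and $\psi_k=\big[\big((JH)^{k-1}H\big)\frac{\partial}{\partial z}\big]$ when $z$ are commutative variables.
   Context: $K$ is a unital commutative $\mathbb Q$-algebra, $z=(z_1,\dots,z_n)$ are commutative or noncommutative free variables, and $t$ is a formal parameter commuting with $z$ and $K$. $K\langle\langle z\rangle\rangle$ and $K[[t]]\langle\langle z\rangle\rangle$ are the formal power series algebras in $z$ (in either the commutative or the noncommutative case); $o(\cdot)$ is the order in $z$. For $\alpha\ge1$, $\mathbb E_t^{[\alpha]}\langle\langle z\rangle\rangle$ is the set of automorphisms of $K[[t]]\langle\langle z\rangle\rangle$ over $K[[t]]$ of the form $F_t(z)=z-tH(z)$ with $H(z)\in K\langle\langle z\rangle\rangle^{\times n}$, $o(H(z))\ge\alpha$. Its inverse map $G_t=F_t^{-1}$ is written $G_t(z)=z+tN_t(z)$, and $N_{[m]}(z)\in K\langle\langle z\rangle\rangle^{\times n}$ ($m\ge1$) are defined by $N_t(z)=\sum_{m\ge1}t^{m-1}N_{[m]}(z)$. For a vector $\vec u=(u_1,\dots,u_n)$ of power series, $[\vec u\frac{\partial}{\partial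 z}]$ is the derivation sending $z_i$ to $u_i$; operators are applied to vectors componentwise, so $Pz=(Pz_1,\dots,Pz_n)$. $C_m(z)\in K\langle\langle z\rangle\rangle^{\times n}$ are defined by $C_1(z)=H(z)$ and $C_m(z)=[C_{m-1}(z)\frac{\partial}{\partial z}]H(z)$ for $m\ge2$. $JH$ is the Jacobian matrix of $H$. A composition is a nonempty finite sequence $I=(i_1,\dots,i_k)$ of positive integers; $|I|=i_1+\cdots+i_k$; $\mathcal C_m$ is the set of compositions with $|I|=m$; $\psi^I=\psi_{i_1}\cdots\psi_{i_k}$ (composition of operators); $\pi_u(I)=\prod_{j=1}^k(i_1+\cdots+i_j)$. *)

(* Defs.v *)
From HB Require Import structures.
From mathcomp Require Import all_boot all_order all_algebra finmap.
From mathcomp Require Import monalg zify.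
From mathcomp Require boolp.

Set Implicit Arguments.
Unset Strict Implicit.
Unset Printing Implicit Defensive.

Import GRing.Theory.
Local Open Scope ring_scope.

Notation "x *m* y" := (@mmul _ x y) (at level 40, left associativity).

(* Monomials in n variables: {fmonom 'I_n} (words, for noncommutative free    *)
(* variables) and {cmonom 'I_n} (exponent vectors, for commutative ones).     *)
(* [factors m] lists the pairs (a, b) with a * b = m, which makes the Cauchy  *)
(* product of arbitrary (infinite) formal series a finite sum.                *)
HB.mixin Record MonomialDef_isVarMonom (n : nat) V of MonomialDef V := {
  factors : V -> seq (V * V);
  factors_uniq : forall m, uniq (factors m);
  mem_factors : forall m p, (p \in factors m) = (p.1 *m* p.2 == m);
  mvar : 'I_n -> V;
  tdeg : V -> nat;
  tdeg1 : tdeg (@mone V) = 0%N;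
  tdegM : forall a b, tdeg (a *m* b) = (tdeg a + tdeg b)%N;
  tdeg_var : forall i, tdeg (mvar i) = 1%N;
  monom_split : forall m, m = (@mone V) \/ exists i m', m = mvar i *m* m'
}.

HB.structure Definition VarMonom (n : nat) :=
  { V of MonomialDef V & MonomialDef_isVarMonom n V }.

Notation varMonomType := VarMonom.type.

HB.structure Definition ComVarMonom (n : nat) :=
  { V of VarMonom n V & ConomialDef V }.

Notation comVarMonomType := ComVarMonom.type.

Section FreeMonomials.
Variable n : nat.
Implicit Types m : {fmonom 'I_n}.

Definition fm_factors m : seq ({fmonom 'I_n} * {fmonom 'I_n}) :=
  [seq (FMonom (take k m), FMonom (drop k m)) | k <- iota 0 (size m).+1].

Lemma fm_factors_uniq m : uniq (fm_factors m).
Proof.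
rewrite map_inj_in_uniq ?iota_uniq // => k l; rewrite !mem_iota /= !add0n !ltnS.
move=> km lm [/(congr1 size)]; rewrite !size_take_min => + _.
by move/minn_idPl: km => ->; move/minn_idPl: lm => ->.
Qed.

Lemma mem_fm_factors m p : (p \in fm_factors m) = (p.1 *m* p.2 == m).
Proof.
rewrite fmP fmM; apply/mapP/eqP => [[k _ ->] /=|]; first exact: cat_take_drop.
case: p => -[a] [b] mE; exists (size a).
  by rewrite mem_iota -mE size_cat /= add0n ltnS leq_addr.
by rewrite -mE /= take_size_cat // drop_size_cat.
Qed.

Lemma fm_split m : m = (@mone {fmonom 'I_n}) \/ exists i m', m = fmu i *m* m'.
Proof.
case: m => [[|i s]]; [left|right].
  by apply/eqP; rewrite fmP fm1.
by exists i, (FMonom s); apply/eqP; rewrite fmP fmM fmU.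
Qed.

HB.instance Definition _ := MonomialDef_isVarMonom.Build n {fmonom 'I_n}
  fm_factors_uniq mem_fm_factors (@fdeg1 'I_n) (@fdegM 'I_n) (@fdegU 'I_n)
  fm_split.
End FreeMonomials.

Section CommutativeMonomials.
Variable n : nat.
Implicit Types m : {cmonom 'I_n}.

Definition cm_of_ffun k (f : {ffun 'I_n -> 'I_k}) : {cmonom 'I_n} :=
  [cmonom (f i : nat) | i in [fset i | i in 'I_n]%fset]%M.

Lemma cm_of_ffunE k (f : {ffun 'I_n -> 'I_k}) i : cm_of_ffun f i = f i.
Proof. by rewrite /cm_of_ffun cmE fsfun_fun in_imfset. Qed.

Lemma leq_mdeg m i : (m i <= mdeg m)%N.
Proof.
rewrite mdegE; case: mdomP => // im.
by rewrite (big_fsetD1 i) //= leq_addr.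
Qed.

Definition cm_factors m : seq ({cmonom 'I_n} * {cmonom 'I_n}) :=
  [seq (cm_of_ffun f, divcm m (cm_of_ffun f))
  | f : {ffun 'I_n -> 'I_(mdeg m).+1} in
      [pred f : {ffun 'I_n -> 'I_(mdeg m).+1} | [forall i, (f i <= m i)%N]]].

Lemma cm_factors_uniq m : uniq (cm_factors m).
Proof.
rewrite map_inj_uniq ?enum_uniq // => f g [+ _] => /eqP/cmP fg.
by apply/ffunP => i; apply: val_inj; have := fg i; rewrite !cm_of_ffunE.
Qed.

Lemma mem_cm_factors m p : (p \in cm_factors m) = (p.1 *m* p.2 == m).
Proof.
apply/mapP/cmP => [[f + ->] i /=|].
  rewrite mem_enum inE => /forallP/(_ i) fm.
  by rewrite cmM divcmE cm_of_ffunE subnKC.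
case: p => a b /= abE.
have aE i : cm_of_ffun [ffun i => inord (a i) : 'I_(mdeg m).+1] i = a i.
  rewrite cm_of_ffunE ffunE inordK // ltnS (leq_trans _ (leq_mdeg m i)) //.
  by rewrite -abE cmM leq_addr.
exists [ffun i => inord (a i)].
  rewrite mem_enum inE; apply/forallP => i.
  by have := aE i; rewrite cm_of_ffunE => ->; rewrite -abE cmM leq_addr.
congr pair; apply/eqP/cmP => i; rewrite ?divcmE ?aE //.
by rewrite -abE cmM addKn.
Qed.

Lemma cm_split m : m = (@mone {cmonom 'I_n}) \/ exists i m', m = ucm i *m* m'.
Proof.
have [->|m1] := eqVneq m (@mone _); [by left|right].
have [i mi] : exists i, m i != 0%N.
  apply/existsP; apply: contraNT m1; rewrite negb_exists => /forallP m0.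
  by apply/cmP => i; rewrite cm1; apply/eqP; rewrite -[_ == _]negbK.
exists i, (divcm m (ucm i)); apply/eqP/cmP => j; rewrite cmM divcmE cmU.
by case: eqVneq => [<-|_]; rewrite ?subn0 // subnKC // lt0n.
Qed.

HB.instance Definition _ := MonomialDef_isVarMonom.Build n {cmonom 'I_n}
  cm_factors_uniq mem_cm_factors (@mdeg1 'I_n) (@mdegM 'I_n) (@mdegU 'I_n)
  cm_split.
End CommutativeMonomials.

(* Formal power series: arbitrary families of coefficients.                   *)
Record fps (R : Type) (M : Type) := Fps { fcoef : M -> R }.
Coercion fcoef : fps >-> Funclass.

Notation "[ 'fps' m => E ]" := (Fps (fun m => E)) (at level 0, m name).
Notation ncfps R n := (fps R {fmonom 'I_n}).
Notation cfps R n := (fps R {cmonom 'I_n}).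

HB.instance Definition _ R M := boolp.gen_eqMixin (fps R M).
HB.instance Definition _ R M := boolp.gen_choiceMixin (fps R M).

Lemma fpsP R M (f g : fps R M) : (forall m, f m = g m) <-> f = g.
Proof.
split=> [|->//]; case: f g => f [g] /= fg; congr Fps; exact: boolp.funext.
Qed.

Section FpsZmod.
Variables (R : zmodType) (M : Type).
Implicit Types f g : fps R M.

Definition fps_zero : fps R M := [fps m => 0].
Definition fps_opp f : fps R M := [fps m => - f m].
Definition fps_add f g : fps R M := [fps m => f m + g m].

Lemma fps_addA : associative fps_add.
Proof. by move=> f g h; apply/fpsP => m /=; rewrite addrA. Qed.
Lemma fps_addC : commutative fps_add.
Proof. by move=> f g; apply/fpsP => m /=; rewrite addrC. Qed.
Lemma fps_add0 : left_id fps_zero fps_add.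
Proof. by move=> f; apply/fpsP => m /=; rewrite add0r. Qed.
Lemma fps_addN : left_inverse fps_zero fps_opp fps_add.
Proof. by move=> f; apply/fpsP => m /=; rewrite addNr. Qed.

HB.instance Definition _ := GRing.isZmodule.Build (fps R M)
  fps_addA fps_addC fps_add0 fps_addN.

Lemma fps0E m : (0 : fps R M) m = 0. Proof. by []. Qed.
Lemma fpsDE f g m : (f + g) m = f m + g m. Proof. by []. Qed.
Lemma fpsNE f m : (- f) m = - f m. Proof. by []. Qed.
Lemma fps_sumE (I : Type) (r : seq I) (P : pred I) (F : I -> fps R M) m :
  (\sum_(i <- r | P i) F i) m = \sum_(i <- r | P i) F i m.
Proof.
exact: (big_morph (fun f : fps R M => f m) (fun f g => fpsDE f g m) (fps0E m)).
Qed.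
End FpsZmod.

Section FpsRing.
Variables (R : nzRingType) (n : nat) (M : varMonomType n).
Implicit Types (f g h : fps R M) (m : M).

Definition fps_monom (a : M) : fps R M := [fps m => (m == a)%:R].
Definition fps_mul f g : fps R M :=
  [fps m => \sum_(p <- factors m) f p.1 * g p.2].

Lemma factorsA (V : nmodType) (F : M -> M -> M -> V) m :
  \sum_(p <- factors m) \sum_(q <- factors p.1) F q.1 q.2 p.2 =
  \sum_(p <- factors m) \sum_(q <- factors p.2) F p.1 q.1 q.2.
Proof.
rewrite -(big_allpairs_dep (h := fun p q : M * M => (q.1, q.2, p.2))
  (r2 := fun p : M * M => factors p.1) (r1 := factors m) (F := fun t => F t.1.1 t.1.2 t.2)).
rewrite -(big_allpairs_dep (h := fun p q : M * M => (p.1, q.1, q.2))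
  (r2 := fun p : M * M => factors p.2) (r1 := factors m) (F := fun t => F t.1.1 t.1.2 t.2)).
apply: perm_big; apply: uniq_perm.
- apply: allpairs_uniq_dep => [|p _|]; [exact: factors_uniq..|].
  move=> t1 t2 /allpairsPdep[[p1 p2] [[q1 q2] [_ + ->]]].
  move=> + /allpairsPdep[[r1 r2] [[s1 s2] [_ + ->]]] /=.
  by rewrite !mem_factors /= => /eqP <- /eqP <- [-> -> ->].
- apply: allpairs_uniq_dep => [|p _|]; [exact: factors_uniq..|].
  move=> t1 t2 /allpairsPdep[[p1 p2] [[q1 q2] [_ + ->]]].
  move=> + /allpairsPdep[[r1 r2] [[s1 s2] [_ + ->]]] /=.
  by rewrite !mem_factors /= => /eqP <- /eqP <- [-> -> ->].
move=> t; apply/allpairsPdep/allpairsPdep => -[[p1 p2] [[q1 q2] []]];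
  rewrite !mem_factors /= => /eqP pE /eqP qE ->.
  exists (q1, q2 *m* p2), (q2, p2); rewrite !mem_factors /= eqxx.
  by rewrite mulmA qE pE.
exists (p1 *m* q1, q2), (p1, q1); rewrite !mem_factors /= eqxx.
by rewrite -mulmA qE pE.
Qed.

Lemma factors_only (V : nmodType) m a b (F : M * M -> V) :
    a *m* b = m ->
    (forall p, p.1 *m* p.2 = m -> p != (a, b) -> F p = 0) ->
  \sum_(p <- factors m) F p = F (a, b).
Proof.
move=> abE F0; rewrite (bigD1_seq (a, b)) /= ?factors_uniq ?mem_factors ?abE //.
rewrite big_seq_cond big1 ?addr0 // => p /andP[+ pab].
by rewrite mem_factors => /eqP/F0; apply.
Qed.

Lemma fps_mulA : associative fps_mul.
Proof.
move=> f g h; apply/fpsP => m /=.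
under eq_bigr do rewrite mulr_sumr.
under [RHS]eq_bigr do rewrite mulr_suml.
rewrite (factorsA (fun a b c => f a * g b * h c)).
by apply: eq_bigr => p _; apply: eq_bigr => q _; rewrite mulrA.
Qed.

Lemma fps_mul1f : left_id (fps_monom (@mone M)) fps_mul.
Proof.
move=> f; apply/fpsP => m /=; rewrite (@factors_only _ _ (@mone M) m) ?mul1m //=.
  by rewrite eqxx mul1r.
case=> a b /= abm; case: (a =P _) => [a1|_]; last by rewrite mul0r.
by rewrite -abm a1 mul1m eqxx.
Qed.

Lemma fps_mulf1 : right_id (fps_monom (@mone M)) fps_mul.
Proof.
move=> f; apply/fpsP => m /=; rewrite (@factors_only _ _ m (@mone M)) ?mulm1 //=.
  by rewrite eqxx mulr1.
case=> a b /= abm; case: (b =P _) => [b1|_]; last by rewrite mulr0.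
by rewrite -abm b1 mulm1 eqxx.
Qed.

Lemma fps_mulDl : left_distributive fps_mul +%R.
Proof.
move=> f g h; apply/fpsP => m; rewrite fpsDE /= -big_split /=.
by apply: eq_bigr => p _; rewrite mulrDl.
Qed.

Lemma fps_mulDr : right_distributive fps_mul +%R.
Proof.
move=> f g h; apply/fpsP => m; rewrite fpsDE /= -big_split /=.
by apply: eq_bigr => p _; rewrite mulrDr.
Qed.

Lemma fps_one_neq0 : fps_monom (@mone M) != 0.
Proof.
apply/eqP => /fpsP/(_ (@mone M)); rewrite /= eqxx => /eqP.
by rewrite oner_eq0.
Qed.

HB.instance Definition _ := GRing.Zmodule_isNzRing.Build (fps R M)
  fps_mulA fps_mul1f fps_mulf1 fps_mulDl fps_mulDr fps_one_neq0.

Lemma fps1E m : (1 : fps R M) m = (m == (@mone M))%:R. Proof. by []. Qed.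
Lemma fpsME f g m : (f * g) m = \sum_(p <- factors m) f p.1 * g p.2.
Proof. by []. Qed.

Definition fps_scale (c : R) f : fps R M := [fps m => c * f m].

Lemma fps_scaleA a b f : fps_scale a (fps_scale b f) = fps_scale (a * b) f.
Proof. by apply/fpsP => m /=; rewrite mulrA. Qed.
Lemma fps_scale1 : left_id 1 fps_scale.
Proof. by move=> f; apply/fpsP => m /=; rewrite mul1r. Qed.
Lemma fps_scaleDr : right_distributive fps_scale +%R.
Proof. by move=> c f g; apply/fpsP => m /=; rewrite mulrDr. Qed.
Lemma fps_scaleDl f : {morph fps_scale^~ f : a b / a + b}.
Proof. by move=> a b; apply/fpsP => m /=; rewrite mulrDl. Qed.

HB.instance Definition _ := GRing.Zmodule_isLmodule.Build R (fps R M)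
  fps_scaleA fps_scale1 fps_scaleDr fps_scaleDl.

Lemma fpsZE c f m : (c *: f) m = c * f m. Proof. by []. Qed.

Lemma fps_scaleAl c f g : c *: (f * g) = (c *: f) * g.
Proof.
apply/fpsP => m; rewrite fpsZE !fpsME mulr_sumr.
by apply: eq_bigr => p _; rewrite fpsZE mulrA.
Qed.

HB.instance Definition _ :=
  GRing.Lmodule_isLalgebra.Build R (fps R M) fps_scaleAl.
End FpsRing.

Section FpsAlgebra.
Variables (R : comNzRingType) (n : nat) (M : varMonomType n).

Lemma fps_scaleAr (c : R) (f g : fps R M) : c *: (f * g) = f * (c *: g).
Proof.
apply/fpsP => m; rewrite fpsZE !fpsME mulr_sumr.
by apply: eq_bigr => p _; rewrite fpsZE mulrCA.
Qed.

HB.instance Definition _ :=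
  GRing.Lalgebra_isAlgebra.Build R (fps R M) fps_scaleAr.
End FpsAlgebra.

Section FpsCommutative.
Variables (R : comNzRingType) (n : nat) (M : comVarMonomType n).

Lemma factorsC (V : nmodType) (F : M * M -> V) m :
  \sum_(p <- factors m) F p = \sum_(p <- factors m) F (p.2, p.1).
Proof.
rewrite -[RHS](big_map (fun p => (p.2, p.1)) xpredT).
apply: perm_big; apply: uniq_perm; rewrite ?factors_uniq //.
  by rewrite map_inj_uniq ?factors_uniq // => -[a b] [c d] [-> ->].
case=> a b; rewrite mem_factors /=.
apply/idP/mapP => [|[[c d]]].
  by exists (b, a); rewrite // mem_factors /= mulmC.
by rewrite mem_factors /= mulmC => + [-> ->].
Qed.

Lemma fps_mulC (f g : fps R M) : f * g = g * f.
Proof.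
apply/fpsP => m; rewrite !fpsME factorsC.
by apply: eq_bigr => p _; rewrite mulrC.
Qed.

HB.instance Definition _ :=
  GRing.PzRing_hasCommutativeMul.Build (fps R M) fps_mulC.
End FpsCommutative.

Section Derivations.
Variables (R : comNzRingType) (n : nat).

Definition fps_var (M : varMonomType n) (i : 'I_n) : fps R M :=
  fps_monom R (mvar i).

Definition derivation_sending (M : varMonomType n) (u : 'cV[fps R M]_n)
    (D : fps R M -> fps R M) : Prop :=
  [/\ linear D,
      forall f g, D (f * g) = D f * g + f * D g &
      forall i, D (fps_var M i) = u i 0].

(* The coefficient of [u d/dz] f at a word w collects, over all ways of       *)
(* writing w = abc, the terms a z_i c of f in which z_i is replaced by the    *)
(* monomial b of u_i.                                                         *)
Definition ncderiv (u : 'cV[ncfps R n]_n) (f : ncfps R n) : ncfps R n :=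
  [fps w => \sum_(p <- factors w) \sum_(q <- factors p.2)
     \sum_(i < n) f (p.1 *m* mvar i *m* q.2) * u i 0 q.1].

Definition partial (i : 'I_n) (f : cfps R n) : cfps R n :=
  [fps m => f (m *m* mvar i) *+ (m i).+1].

Definition cderiv (u : 'cV[cfps R n]_n) (f : cfps R n) : cfps R n :=
  \sum_(i < n) u i 0 * partial i f.

Definition jacobian (H : 'cV[cfps R n]_n) : 'M[cfps R n]_n :=
  \matrix_(i, j) partial j (H i 0).

End Derivations.

Arguments fps_var {R n} M i.

Section DerivationTheory.
Variables (R : comNzRingType) (n : nat).

Lemma fps_head_split (M : varMonomType n) (f : fps R M) :
  exists g : 'I_n -> fps R M,
    f = (f (@mone M))%:A + \sum_(i < n) fps_var M i * g i.
Proof.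
pose P m o := if o is Some (i, m') then m = mvar i *m* m' else m = @mone M.
have [s sP] : {s : M -> option ('I_n * M) & forall m, P m (s m)}.
  apply: boolp.choice => m.
  case: (monom_split m) => [->|[i [m' ->]]]; first by exists None.
  by exists (Some (i, m')).
exists (fun i => [fps m => if s (mvar i *m* m) == Some (i, m)
                           then f (mvar i *m* m) else 0]).
have var_neq1 i m : mvar i *m* m != @mone M.
  by apply/eqP => /(congr1 (@tdeg n M)); rewrite tdegM tdeg_var tdeg1.
apply/fpsP => m; rewrite fpsDE fps_sumE fpsZE fps1E.
under eq_bigr do rewrite fpsME /=.
have [->|m1] := eqVneq m (@mone M).
  rewrite mulr1 big1 ?addr0 // => i _; rewrite big_seq big1 // => -[a b] /=.
  rewrite mem_factors /=; case: (a =P mvar i) => [->|_ _]; last by rewrite mul0r.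
  by rewrite (negbTE (var_neq1 i b)).
rewrite mulr0 add0r; have := sP m; rewrite /P; case sm: (s m) => [[j m0]|]; last first.
  by move=> m1'; rewrite m1' eqxx in m1.
move=> mE; rewrite (bigD1 j) //= [X in _ + X]big1 => [|i ij]; last first.
  rewrite big_seq big1 // => -[a b] /=; rewrite mem_factors /=.
  case: (a =P mvar i) => [-> /eqP ->|_ _]; last by rewrite mul0r.
  rewrite sm; case: (_ =P Some (i, b)) => [[ji _]|]; last by rewrite mulr0.
  by rewrite ji eqxx in ij.
rewrite addr0 (@factors_only n M _ m (mvar j) m0) //=.
  by rewrite -mE sm !eqxx mul1r.
case=> a b /= abm; case: (a =P mvar j) => [aj|]; last by rewrite mul0r.
rewrite -aj abm sm; case: (_ =P Some (j, b)) => [[->]|]; rewrite ?mulr0 //.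
by rewrite aj eqxx.
Qed.

Lemma derivation_sending_uniq (M : varMonomType n) (u : 'cV[fps R M]_n) D D' :
  derivation_sending u D -> derivation_sending u D' -> D =1 D'.
Proof.
move=> [Dl DM Dz] [Dl' DM' Dz'].
pose E f := D f - D' f.
have EM f g : E (f * g) = E f * g + f * E g.
  by rewrite /E DM DM' mulrBl mulrBr opprD addrACA.
have El a f g : E (a *: f + g) = a *: E f + E g.
  by rewrite /E Dl Dl' scalerBr opprD addrACA.
have ED f g : E (f + g) = E f + E g by have := El 1 f g; rewrite !scale1r.
have E0 : E 0 = 0.
  by have /eqP := ED 0 0; rewrite addr0 -subr_eq subrr => /eqP <-.
have EZ a f : E (a *: f) = a *: E f by have := El a f 0; rewrite E0 !addr0.
have E1 : E 1 = 0.
  have /eqP := EM 1 1; rewrite !mulr1 mul1r -subr_eq subrr => /eqP <- //.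
have Ez i : E (fps_var M i) = 0 by rewrite /E Dz Dz' subrr.
have Esum (F : 'I_n -> fps R M) : E (\sum_i F i) = \sum_i E (F i).
  exact: (big_morph E ED E0).
suff E_ord k f m : (tdeg m < k)%N -> E f m = 0.
  move=> f; apply/eqP; rewrite -subr_eq0; apply/eqP/fpsP => m.
  exact: (E_ord (tdeg m).+1).
clearbody E; elim: k f m => [//|k IH] f m mk.
have [g ->] := fps_head_split f.
rewrite ED EZ E1 scaler0 add0r Esum fps_sumE big1 // => i _.
rewrite EM Ez mul0r add0r fpsME big_seq big1 // => -[a b] /=.
rewrite mem_factors /=; case: (a =P mvar i) => [-> /eqP abm|_ _]; last by rewrite mul0r.
by rewrite IH ?mulr0 //; move: mk; rewrite -abm tdegM tdeg_var.
Qed.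

Lemma partialE i (f : cfps R n) m :
  partial i f m = f (m *m* mvar i) *+ (m i).+1.
Proof. by []. Qed.

Lemma partial_linear i : linear (@partial R n i).
Proof.
move=> c f g; apply/fpsP => m.
by rewrite fpsDE fpsZE !partialE fpsDE fpsZE mulrnDl mulrnAr.
Qed.

Lemma partialM i (f g : cfps R n) :
  partial i (f * g) = partial i f * g + f * partial i g.
Proof.
have half (F G : cfps R n) m :
    \sum_(p <- factors (m *m* mvar i)) F p.1 * G p.2 *+ p.1 i =
    (partial i F * G) m.
  rewrite fpsME [LHS](bigID (fun p : {cmonom 'I_n} * {cmonom 'I_n} => p.1 i == 0%N)) /=.
  rewrite big1 ?add0r => [|p /eqP->]; last by rewrite mulr0n.
  transitivity (\sum_(p <- [seq (p.1 *m* mvar i, p.2) | p <- factors m])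
                 F p.1 * G p.2 *+ p.1 i); last first.
    by rewrite big_map; apply: eq_bigr => p _; rewrite cmM cmUU addn1 -mulrnAl.
  rewrite -big_filter.
  apply: perm_big; apply: uniq_perm.
  - by rewrite filter_uniq ?factors_uniq.
  - rewrite map_inj_uniq ?factors_uniq // => -[a b] [c d] [/eqP/cmP ac ->].
    congr pair; apply/eqP/cmP => j; have := ac j; rewrite !cmM.
    exact: addIn.
  case=> a b; rewrite mem_filter mem_factors /=.
  apply/andP/mapP => [[ai /eqP/eqP/cmP abm]|[[c d]]].
    have acE : divcm a (mvar i) *m* mvar i = a.
      apply/eqP/cmP => j; rewrite cmM divcmE cmU.
      by case: eqVneq => [<-|_]; rewrite ?subn0 ?addn0 // subnK // lt0n.
    exists (divcm a (mvar i), b); last by rewrite /= acE.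
    rewrite mem_factors /=; apply/cmP => j; have := abm j.
    rewrite -{1}acE !cmM addnAC; exact: addIn.
  rewrite mem_factors /= => /eqP <- [-> ->]; split.
    by rewrite cmM cmUU addn1.
  by rewrite -!mulmA [d *m* _]mulmC.
apply/fpsP => m; rewrite fpsDE -half [f * partial i g]mulrC -half.
rewrite [X in _ + X]factorsC -big_split /= -sumrMnl.
rewrite big_seq [RHS]big_seq; apply: eq_bigr => p.
rewrite mem_factors => /eqP/(congr1 (fun m' : {cmonom 'I_n} => m' i)).
by rewrite !cmM cmUU addn1 => <-; rewrite mulrnDr [g _ * _]mulrC.
Qed.

Lemma cderivP (u : 'cV[cfps R n]_n) : derivation_sending u (cderiv u).
Proof.
split=> [c f g|f g|i].
- rewrite /cderiv scaler_sumr -big_split; apply: eq_bigr => i _ /=.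
  by rewrite partial_linear mulrDr scalerAr.
- rewrite /cderiv mulr_suml mulr_sumr -big_split; apply: eq_bigr => i _ /=.
  by rewrite partialM mulrDr mulrA mulrCA.
have pz j : partial j (fps_var _ i) = (i == j)%:R :> cfps R n.
  apply/fpsP => m; rewrite partialE /=.
  have -> : (m *m* mvar j == mvar i) = (i == j) && (m == @mone _).
    apply/eqP/andP => [mji|[/eqP -> /eqP ->]]; last by rewrite mul1m.
    have /mdeg_eq0I m1 : mdeg m = 0%N.
      by have := congr1 (@tdeg n _) mji; rewrite tdegM !tdeg_var addn1 => -[].
    split; last by rewrite m1.
    have /eqP/cmP/(_ j) := mji; rewrite m1 mul1m !cmU eqxx.
    by case: (i == j).
  case: (i == j); rewrite ?andFb ?andTb; last by rewrite mul0rn.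
  by rewrite mulr1n fps1E; case: eqP => [->|_]; rewrite ?mul0rn // cm1.
rewrite /cderiv (bigD1 i) //= pz eqxx mulr1 big1 ?addr0 // => j ji.
by rewrite pz eq_sym (negbTE ji) mulr0.
Qed.

Lemma ncderivE (u : 'cV[ncfps R n]_n) f w :
  ncderiv u f w = \sum_(p <- factors w) \sum_(q <- factors p.2)
    \sum_(i < n) f (p.1 *m* mvar i *m* q.2) * u i 0 q.1.
Proof. by []. Qed.

Lemma fm_lcancel (a b c : {fmonom 'I_n}) : a *m* b = a *m* c -> b = c.
Proof.
move/eqP; rewrite fmP !fmM eqseq_cat // eqxx /= => /eqP; exact: val_inj.
Qed.

Lemma fm_rcancel (a b c : {fmonom 'I_n}) : b *m* a = c *m* a -> b = c.
Proof.
move/eqP; rewrite fmP !fmM => /eqP/(congr1 rev).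
rewrite !rev_cat => /eqP; rewrite eqseq_cat // eqxx /= => /eqP.
by move/(congr1 rev); rewrite !revK; exact: val_inj.
Qed.

Lemma fm_take_drop (w : {fmonom 'I_n}) k :
  FMonom (take k w) *m* FMonom (drop k w) = w.
Proof. by apply/eqP; rewrite fmP fmM /= cat_take_drop. Qed.

Lemma factors_insert (V : nmodType) (F : {fmonom 'I_n} * {fmonom 'I_n} -> V)
    (a c : {fmonom 'I_n}) i :
  \sum_(p <- factors (a *m* mvar i *m* c)) F p =
  \sum_(p <- factors a) F (p.1, p.2 *m* mvar i *m* c) +
  \sum_(p <- factors c) F (a *m* mvar i *m* p.1, p.2).
Proof.
have wE : a *m* mvar i *m* c = a ++ i :: c :> seq 'I_n.
  by rewrite !fmM fmU -catA.
rewrite -[X in _ = X + _](big_map (fun p => (p.1, p.2 *m* mvar i *m* c)) xpredT).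
rewrite -[X in _ = _ + X](big_map (fun p => (a *m* mvar i *m* p.1, p.2)) xpredT).
rewrite -big_cat; apply: perm_big; apply: uniq_perm => [||p].
- exact: factors_uniq.
- rewrite cat_uniq; apply/and3P; split; first 2 last.
  + rewrite map_inj_uniq ?factors_uniq // => -[r s] [r' s'].
    by case=> /fm_lcancel -> ->.
  + rewrite map_inj_uniq ?factors_uniq // => -[r s] [r' s'].
    by case=> -> /fm_rcancel/fm_rcancel ->.
  apply/hasPn => _ /mapP[[r s] _ ->].
  apply/negP => /mapP[[r' s']]; rewrite mem_factors /= => /eqP <- [/(congr1 (@tdeg n _))].
  by rewrite !tdegM tdeg_var => + _; lia.
rewrite mem_cat; apply/idP/orP; last first.
  case=> /mapP[[r s]]; rewrite !mem_factors /= => /eqP <- -> /=.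
    by rewrite !mulmA.
  by rewrite !mulmA.
case: p => r s; rewrite mem_factors => /eqP; rewrite -[_.1 *m* _]/(r *m* s) => rsE.
have rs_seq : r ++ s = a ++ (i :: c) :> seq 'I_n by rewrite -fmM rsE.
have [ra|ar] := leqP (size r) (size a).
  have rE : FMonom (take (size r) a) = r.
    apply: val_inj => /=; have /(congr1 (take (size r))) := rs_seq.
    by rewrite take_size_cat // takel_cat.
  left; apply/mapP; exists (r, FMonom (drop (size r) a)).
    by rewrite mem_factors /= -{1}rE fm_take_drop.
  congr pair; apply: (@fm_lcancel r).
  by rewrite rsE !mulmA -{1}rE fm_take_drop.
have rE : FMonom (take (size a).+1 r) = a *m* mvar i.
  apply: val_inj; rewrite /= fmM fmU /=.
  have /(congr1 (take (size a).+1)) := rs_seq; rewrite takel_cat // => ->.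
  by rewrite cats1 -cat_rcons take_size_cat ?size_rcons.
right; apply/mapP; exists (FMonom (drop (size a).+1 r), s); last first.
  by rewrite /= -rE fm_take_drop.
rewrite mem_factors /=; apply/eqP/(@fm_lcancel (a *m* mvar i)).
by rewrite mulmA -{1}rE fm_take_drop.
Qed.

Lemma fm_var_sandwich (a c : {fmonom 'I_n}) i j :
  (a *m* mvar j *m* c == mvar i) = [&& a == @mone _, c == @mone _ & j == i].
Proof.
apply/eqP/and3P => [acE|[/eqP -> /eqP -> /eqP ->]]; last by rewrite mul1m mulm1.
have := congr1 (@tdeg n _) acE; rewrite !tdegM !tdeg_var => degE.
have /fdeg_eq0I a1 : fdeg a = 0%N by move: degE; rewrite /tdeg /=; lia.
have /fdeg_eq0I c1 : fdeg c = 0%N by move: degE; rewrite /tdeg /=; lia.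
move: acE; rewrite a1 c1 mul1m mulm1 !eqxx => /eqP.
by rewrite fmP !fmU => /eqP[->].
Qed.

Lemma ncderivP (u : 'cV[ncfps R n]_n) : derivation_sending u (ncderiv u).
Proof.
split=> [c f g|f g|i]; apply/fpsP => w.
- rewrite fpsDE fpsZE !ncderivE mulr_sumr -big_split; apply: eq_bigr => p _.
  rewrite mulr_sumr -big_split; apply: eq_bigr => q _.
  rewrite mulr_sumr -big_split; apply: eq_bigr => i _.
  by rewrite fpsDE fpsZE mulrDl mulrA.
- rewrite ncderivE.
  under eq_bigr do under eq_bigr do under eq_bigr do
    rewrite fpsME factors_insert mulrDl.
  under eq_bigr do under eq_bigr do rewrite big_split.
  under eq_bigr do rewrite big_split.
  rewrite big_split [ncderiv u f * g + _]addrC fpsDE !fpsME; congr (_ + _); last first.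
    pose G a b c e := \sum_(i < n) f (a *m* mvar i *m* c) * u i 0 b * g e.
    transitivity (\sum_(p <- factors w) \sum_(q <- factors p.2)
                    \sum_(s <- factors q.2) G p.1 q.1 s.1 s.2).
      apply: eq_bigr => p _; apply: eq_bigr => q _.
      under eq_bigr do rewrite mulr_suml; rewrite exchange_big.
      by apply: eq_bigr => s _; apply: eq_bigr => i _; rewrite mulrAC.
    under eq_bigr => p _ do rewrite -(factorsA (G p.1)).
    rewrite -(factorsA (fun a y e => \sum_(s <- factors y) G a s.1 s.2 e)).
    apply: eq_bigr => p _; rewrite ncderivE mulr_suml; apply: eq_bigr => q _.
    rewrite mulr_suml; apply: eq_bigr => s _.
    by rewrite mulr_suml.
  pose G a1 a2 r := \sum_(q <- factors r) \sum_(i < n)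
    f a1 * (g (a2 *m* mvar i *m* q.2) * u i 0 q.1).
  transitivity (\sum_(p <- factors w) \sum_(s <- factors p.1) G s.1 s.2 p.2).
    apply: eq_bigr => p _; rewrite /G [RHS]exchange_big.
    apply: eq_bigr => q _; rewrite [RHS]exchange_big; apply: eq_bigr => i _.
    by rewrite mulr_suml; apply: eq_bigr => s _; rewrite mulrA.
  rewrite factorsA; apply: eq_bigr => p _; rewrite ncderivE mulr_sumr.
  apply: eq_bigr => q _; rewrite mulr_sumr; apply: eq_bigr => s _.
  by rewrite mulr_sumr.
rewrite ncderivE (@factors_only n _ _ w (@mone _) w) ?mul1m //; last first.
  case=> a b abE ab; rewrite big1_seq // => q _; rewrite big1 // => j _.
  have -> : fps_var _ i (a *m* mvar j *m* q.2) = 0 :> R; last by rewrite mul0r.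
  rewrite /fps_var /= fm_var_sandwich.
  case: eqP => // a1; case: eqP ab => // -[].
  by move: abE; rewrite a1 /= mul1m => ->.
rewrite (@factors_only n _ _ w w (@mone _)) ?mulm1 //; last first.
  case=> a b abE ab; rewrite big1 // => j _.
  have -> : fps_var _ i (@mone _ *m* mvar j *m* b) = 0 :> R; last by rewrite mul0r.
  rewrite /fps_var /= fm_var_sandwich eqxx.
  case: eqP => // b1; case: eqP ab => // -[].
  by move: abE; rewrite b1 /= mulm1 => ->.
rewrite (bigD1 i) //= big1 ?addr0 => [|j ji].
  by rewrite fm_var_sandwich !eqxx mul1r.
by rewrite fm_var_sandwich !eqxx (negbTE ji) mul0r.
Qed.

End DerivationTheory.

(* K[[t]] is the ring of power series in one commutative variable.            *)
Notation tps K := (cfps K 1).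
Definition tvar (K : comNzRingType) : tps K := fps_var {cmonom 'I_1} ord0.

Section FormalParameter.
Variables (K : comNzRingType) (n : nat) (M : varMonomType n).

(* The inclusion of K<<z>> into K[[t]]<<z>>.                                  *)
Definition fps_const_t (f : fps K M) : fps (tps K) M := [fps w => (f w)%:A].

(* \sum_k t^k a_k; a monomial of K[[t]] is t to the power of its degree.      *)
Definition tseries (a : nat -> fps K M) : fps (tps K) M :=
  [fps w => [fps e => a (tdeg e) w]].

Definition order_ge (d : nat) (f : fps K M) : Prop :=
  forall w, (tdeg w < d)%N -> f w = 0.

(* The automorphism of K[[t]]<<z>> over K[[t]] given by f(z) |-> f(F_t(z)) is *)
(* identified with F_t(z), the vector of the images of the variables.         *)
Definition Et (alpha : nat) (H : 'cV[fps K M]_n)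
    (F : {lrmorphism fps (tps K) M -> fps (tps K) M}) : Prop :=
  [/\ bijective F,
      forall i, order_ge alpha (H i 0) &
      forall i, F (fps_var M i) = fps_var M i - tvar K *: fps_const_t (H i 0)].

Definition Cseq (deriv : 'cV[fps K M]_n -> fps K M -> fps K M)
    (H : 'cV[fps K M]_n) (m : nat) : 'cV[fps K M]_n :=
  iter m.-1 (fun C => map_mx (deriv C) H) H.
End FormalParameter.

Fixpoint compositions (m : nat) : seq (seq nat) :=
  match m with
  | 0 => [::]
  | 1 => [:: [:: 1%N]]
  | m'.+1 => [seq 1%N :: J | J <- compositions m'] ++
             [seq (head 0%N J).+1 :: behead J | J <- compositions m']
  end.

Lemma mem_compositions m I :
  (I \in compositions m) =
  [&& I != [::], all (fun i => 0 < i)%N I & sumn I == m].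
Proof.
elim: m I => [|[|m] IH] I.
- by case: I => [|[|i] I] //=; rewrite ?andbF // addSn.
- case: I => [|[|[|i]] [|[|j] I]] //=; rewrite inE ?andbF //=.
have -> : compositions m.+2 = [seq 1%N :: J | J <- compositions m.+1] ++
  [seq (head 0%N J).+1 :: behead J | J <- compositions m.+1] by [].
rewrite mem_cat; apply/orP/and3P.
  case=> /mapP[J]; rewrite IH => /and3P[J_nil J0 /eqP Jm] -> /=.
    by split; rewrite // Jm.
  case: J J_nil J0 Jm => //= j J _ /andP[_ J0] Jm.
  by split; rewrite // addSn Jm.
case: I => [|[|[|i]] I] [//= _ I0 /eqP Im].
  left; apply/mapP; exists I => //; rewrite IH I0 -eqSS -Im add1n eqxx andbT.
  by apply/andP; split=> //; case: I I0 Im.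
right; apply/mapP; exists (i.+1 :: I) => //; rewrite IH; apply/and3P.
by split=> //; apply/eqP; move: Im; rewrite /= !addSn => -[->].
Qed.

Lemma compositions_uniq m : uniq (compositions m).
Proof.
elim: m => [|[|m] IH] //.
have -> : compositions m.+2 = [seq 1%N :: J | J <- compositions m.+1] ++
  [seq (head 0%N J).+1 :: behead J | J <- compositions m.+1] by [].
rewrite cat_uniq map_inj_uniq ?IH => [|J J' [] //]; apply/and3P; split=> //.
  apply/hasPn => _ /mapP[J + ->]; rewrite mem_compositions => /and3P[].
  move=> J_nil Jpos _; apply/negP => /mapP[J' _ []].
  by case: J J_nil Jpos => [|[|j] J].
rewrite map_inj_in_uniq ?IH // => J J'; rewrite !mem_compositions.
by case: J J' => [|j J] [|j' J'] //= _ _ [-> ->].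
Qed.

Definition pi_u (I : seq nat) : nat :=
  (\prod_(j < size I) sumn (take j.+1 I))%N.

(* psi^I f = psi_{i_1} (psi_{i_2} (... (psi_{i_k} f))).                       *)
Definition psi_comp (T : Type) (psi : nat -> T -> T) (I : seq nat) (f : T) : T :=
  foldr psi f I.

(* Main.v *)
Require Import Defs.
From HB Require Import structures.
From mathcomp Require Import all_boot all_order all_algebra finmap.
From mathcomp Require Import monalg.

Set Implicit Arguments.
Unset Strict Implicit.
Unset Printing Implicit Defensive.

Import GRing.Theory.
Local Open Scope ring_scope.

(** Write psi(t) for the K[[t]]-linear derivation \sum_k t^(k-1) psi_k of
K[[t]]<<z>>, where psi_k is the derivation with coefficient vector C_k. The
recursion defining C_k is designed for the identity
  psi(t) (z_i - t H_i) = H_i,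
because \sum_k t^(k-1) C_k = H + t (psi(t) H). Identify F_t with the
substitution automorphism F and G_t with its inverse G. Then G solves the
linear differential equation
  d/dt (G f) = G (psi(t) f)        (f in K<<z>>).
Indeed the defect f |-> d/dt (G f) - G (d/dt f) - G (psi(t) f) becomes, once
composed with F, an honest K[[t]]-linear derivation of K[[t]]<<z>>, and it kills
every variable since d/dt (F z_i) = - H_i and psi(t) (F z_i) = H_i; a derivation
killing the variables vanishes. This is [dt_inverse].

Write G_m f for the coefficient of t^m in G f. The differential equation reads
  (m + 1) G_(m+1) = \sum_(j <= m) G_(m-j) psi_(j+1)
([inverse_recurrence]), with G_0 the identity ([tcoef0_inverse]). The sum
over compositions in the theorem obeys the same recurrence: detach the last part
of each composition of m + 1, and observe that the last factor of pi_u is the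
size m + 1 of the whole composition ([recurrence_compositions]). Evaluating at
z_i gives the formula. For commutative variables the chain rule gives
[C_(k-1) d/dz] H = (JH) C_(k-1), hence C_k = (JH)^(k-1) H. *)

(** * Monomials in the formal parameter *)

Section Tmon.
Implicit Types e : {cmonom 'I_1}.
Definition tmon (m : nat) : {cmonom 'I_1} :=
  iter m (fun e => e *m* mvar ord0) (@mone _).

#[global] Arguments tmon : simpl never.

Lemma tdeg_tmon m : tdeg (tmon m) = m.
Proof. by elim: m => [|m IH]; rewrite ?tdeg1 //= tdegM IH tdeg_var addn1. Qed.

Lemma tmonS m : tmon m.+1 = mvar ord0 *m* tmon m.
Proof. by rewrite mulmC. Qed.

Lemma tmon_tdeg e : tmon (tdeg e) = e.
Proof.
have [k] := ubnP (tdeg e); elim: k e => // k IH e.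
case: (monom_split e) => [->|[i [e' ->]]]; first by rewrite tdeg1.
rewrite tdegM tdeg_var add1n ltnS => ek.
by rewrite tmonS IH // (ord1 i).
Qed.

(** In one variable the degree determines the monomial; this is what lets
factorizations of t^m be indexed by natural numbers. *)
Lemma tdeg_inj : injective (@tdeg 1 {cmonom 'I_1}).
Proof. by move=> e e' ee'; rewrite -(tmon_tdeg e) ee' tmon_tdeg. Qed.

Lemma sum_factors_tmon (V : nmodType) m
    (f : {cmonom 'I_1} * {cmonom 'I_1} -> V) :
  \sum_(p <- factors (tmon m)) f p =
  \sum_(j < m.+1) f (tmon j, tmon (m - j)).
Proof.
rewrite -(big_mkord xpredT (fun j => f (tmon j, tmon (m - j)))).
rewrite -(big_map (fun j => (tmon j, tmon (m - j))) xpredT).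
apply: perm_big; apply: uniq_perm; rewrite ?factors_uniq //.
  rewrite map_inj_uniq ?iota_uniq // => j k [/(congr1 (@tdeg 1 _))].
  by rewrite !tdeg_tmon.
case=> a b; rewrite mem_factors.
apply/eqP/mapP => [/= abm|[j + [-> ->]]].
  have abd : (tdeg a + tdeg b)%N = m by rewrite -tdegM abm tdeg_tmon.
  exists (tdeg a); first by rewrite mem_index_iota -abd ltnS leq_addr.
  by rewrite -abd addKn !tmon_tdeg.
rewrite mem_index_iota ltnS /= => jm.
by apply: tdeg_inj; rewrite tdegM !tdeg_tmon subnKC.
Qed.
End Tmon.

(** * Derivations *)

Section DerivationLin.
Variables (R : comNzRingType) (n : nat) (M : varMonomType n).
Variables (u : 'cV[fps R M]_n) (D : fps R M -> fps R M).
Hypothesis Dder : derivation_sending u D.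

Lemma derivationD f g : D (f + g) = D f + D g.
Proof. by case: Dder => /(_ 1 f g) + _ _; rewrite !scale1r. Qed.

Lemma derivation0 : D 0 = 0.
Proof. by apply: (addIr (D 0)); rewrite -derivationD !add0r. Qed.

Lemma derivationZ c f : D (c *: f) = c *: D f.
Proof.
by case: Dder => /(_ c f 0) + _ _; rewrite derivation0 !addr0.
Qed.

Lemma derivation_sum (I : Type) (r : seq I) (F : I -> fps R M) :
  D (\sum_(i <- r) F i) = \sum_(i <- r) D (F i).
Proof. exact: (big_morph D derivationD derivation0). Qed.
End DerivationLin.

(** * Coefficients in t, and differentiation with respect to t *)

Section Tcoef.
Variables (K : comNzRingType) (n : nat) (M : varMonomType n).
Implicit Types (e : {cmonom 'I_1}) (f g : fps (tps K) M) (c : tps K).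
Implicit Types (h : fps K M).

(** A series over K[[t]] is handled through its coefficients in K<<z>>; they are
indexed by monomials, not by naturals, so that products in t are again sums over
[factors] and [factorsA] applies to them. *)
Definition tcoef e f : fps K M := [fps w => f w e].

Lemma tcoefP f g : (forall e, tcoef e f = tcoef e g) <-> f = g.
Proof.
split=> [fg|->//]; apply/fpsP => w; apply/fpsP => e.
exact: (congr1 (fun h : fps K M => h w) (fg e)).
Qed.

Lemma tcoef0 e : tcoef e 0 = 0. Proof. by apply/fpsP. Qed.
Lemma tcoefD e : {morph tcoef e : f g / f + g}.
Proof. by move=> f g; apply/fpsP. Qed.

Lemma tcoef_sum e (I : Type) (r : seq I) (F : I -> fps (tps K) M) :
  tcoef e (\sum_(i <- r) F i) = \sum_(i <- r) tcoef e (F i).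
Proof. exact: (big_morph (tcoef e) (tcoefD e) (tcoef0 e)). Qed.

Lemma tcoefM e f g :
  tcoef e (f * g) = \sum_(p <- factors e) tcoef p.1 f * tcoef p.2 g.
Proof.
apply/fpsP => w; rewrite fps_sumE /= fps_sumE.
by rewrite exchange_big.
Qed.

Lemma tcoefZ e c f :
  tcoef e (c *: f) = \sum_(p <- factors e) c p.1 *: tcoef p.2 f.
Proof. by apply/fpsP => w; rewrite fps_sumE. Qed.

Lemma tcoef0M f g :
  tcoef (tmon 0) (f * g) = tcoef (tmon 0) f * tcoef (tmon 0) g.
Proof. by rewrite tcoefM sum_factors_tmon big_ord1. Qed.

Lemma tcoef0Z c f : tcoef (tmon 0) (c *: f) = c (tmon 0) *: tcoef (tmon 0) f.
Proof. by rewrite tcoefZ sum_factors_tmon big_ord1. Qed.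

Lemma tcoef0_tvar f : tcoef (tmon 0) (tvar K *: f) = 0.
Proof.
rewrite tcoef0Z /= [_ == _]negbTE ?scale0r //.
by apply/eqP => /(congr1 (@tdeg 1 _)); rewrite tdeg1 tdeg_var.
Qed.

Lemma tcoefS_tvar m f : tcoef (tmon m.+1) (tvar K *: f) = tcoef (tmon m) f.
Proof.
rewrite tcoefZ (@factors_only _ _ _ _ (mvar ord0) (tmon m)) -?tmonS //=.
  by rewrite eqxx scale1r.
case=> a b /= abm; case: (a =P mvar ord0) => [a1|]; last by rewrite scale0r.
case/eqP; congr pair => //; apply: tdeg_inj; apply: (@addnI (tdeg a)).
by rewrite -tdegM abm a1 tmonS tdegM.
Qed.

Lemma tcoef_const e h : tcoef e (fps_const_t h) = (e == @mone _)%:R *: h.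
Proof. by apply/fpsP => w; rewrite fpsZE /= mulrC. Qed.

Lemma tcoef_tseries e (a : nat -> fps K M) : tcoef e (tseries a) = a (tdeg e).
Proof. by apply/fpsP. Qed.

Lemma fps_var_const i : fps_var M i = fps_const_t (fps_var M i) :> fps (tps K) M.
Proof.
by apply/fpsP => w; apply/fpsP => e /=; case: (w == _); rewrite ?mul1r ?mul0r.
Qed.

Lemma tseries_recl (a : nat -> fps K M) :
  tseries a = fps_const_t (a 0%N) + tvar K *: tseries (fun j => a j.+1).
Proof.
apply/tcoefP => e; rewrite -(tmon_tdeg e) tcoefD tcoef_const tcoef_tseries.
rewrite tdeg_tmon; case: (tdeg e) => [|m].
  by rewrite tcoef0_tvar eqxx scale1r addr0.
rewrite tcoefS_tvar tcoef_tseries tdeg_tmon [_ == _]negbTE ?scale0r ?add0r //.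
by apply/eqP => /(congr1 (@tdeg 1 _)); rewrite tdeg_tmon tdeg1.
Qed.

Definition dt f : fps (tps K) M := [fps w => partial ord0 (f w)].

Lemma dtD : {morph dt : f g / f + g}.
Proof.
move=> f g; apply/fpsP => w /=; have := partial_linear ord0 1 (f w) (g w).
by rewrite !scale1r.
Qed.

Lemma dtM f g : dt (f * g) = dt f * g + f * dt g.
Proof.
apply/fpsP => w; rewrite fpsDE /= -big_split /=.
rewrite (big_morph (partial ord0) (id1 := 0) (op1 := +%R)); first 1 last.
- move=> a b; have := @partial_linear K 1 ord0 1 a b; by rewrite !scale1r.
- by apply/fpsP => e; rewrite partialE mul0rn.
by apply: eq_bigr => p _; rewrite partialM.
Qed.

Lemma dtZ c f : dt (c *: f) = partial ord0 c *: f + c *: dt f.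
Proof. by apply/fpsP => w; rewrite /= partialM. Qed.

Lemma tcoef_dt m f : tcoef (tmon m) (dt f) = tcoef (tmon m.+1) f *+ m.+1.
Proof.
have tE : tmon m (ord0 : 'I_1) = m.
  by elim: m => [|k IH]; rewrite ?cm1 // tmonS cmM IH cmUU.
have fpsMnE (h : fps K M) k w : (h *+ k) w = h w *+ k.
  by elim: k => [|k IH]; rewrite ?mulr0n // !mulrSr fpsDE IH.
by apply/fpsP => w; rewrite fpsMnE /= tE tmonS mulmC.
Qed.

Lemma dt_const h : dt (fps_const_t h) = 0.
Proof.
apply/tcoefP => e; rewrite -(tmon_tdeg e) tcoef_dt tcoef_const tcoef0.
rewrite [_ == _]negbTE ?scale0r ?mul0rn //.
by apply/eqP => /(congr1 (@tdeg 1 _)); rewrite tdeg_tmon tdeg1.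
Qed.

Lemma partial_tvar : partial ord0 (tvar K) = 1.
Proof.
have [_ _ /(_ ord0)] := cderivP (\col_i 1 : 'cV[tps K]_1).
by rewrite /cderiv big_ord1 mxE mul1r.
Qed.

Lemma dt_tvar f : dt (tvar K *: f) = f + tvar K *: dt f.
Proof.
(* The parameter is generalized before the unit law is used: otherwise matching
   its pattern compares the series t and 1 by computation. *)
move: (tvar K) partial_tvar => c c1; apply/fpsP => w.
by rewrite /= partialM c1 mul1r.
Qed.
End Tcoef.
#[global] Arguments tcoef : simpl never.

(** * Series in t of derivations *)

Section Tderiv.
Variables (K : comNzRingType) (n : nat) (M : varMonomType n).
Variables (u : nat -> 'cV[fps K M]_n) (D : nat -> fps K M -> fps K M).
Hypothesis Dder : forall j, derivation_sending (u j) (D j).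
Implicit Types (e : {cmonom 'I_1}) (f g : fps (tps K) M) (h : fps K M).

(** The operator \sum_j t^j D_j, extended K[[t]]-linearly from K<<z>>. *)
Definition tderiv f : fps (tps K) M :=
  [fps w => [fps e =>
    (\sum_(p <- factors e) D (tdeg p.1) (tcoef p.2 f)) w]].

Lemma tcoef_tderiv e f :
  tcoef e (tderiv f) = \sum_(p <- factors e) D (tdeg p.1) (tcoef p.2 f).
Proof. by apply/fpsP. Qed.

Lemma tderiv_const h : tderiv (fps_const_t h) = tseries (fun j => D j h).
Proof.
apply/tcoefP => e; rewrite tcoef_tderiv tcoef_tseries.
rewrite (@factors_only _ _ _ _ e (@mone _)) ?mulm1 //=.
  by rewrite tcoef_const eqxx scale1r.
case=> a b /= abe ab; rewrite tcoef_const; case: (b =P _) ab => [b1|_ _].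
  by move: abe; rewrite b1 mulm1 => ->; rewrite eqxx.
by rewrite scale0r (derivation0 (Dder _)).
Qed.

(** Both the linearity over K[[t]] and the Leibniz rule are coefficientwise
consequences of those of the D_j: each side expands into a sum over the
factorizations of a power of t into three factors, which the two sides nest and
order differently. *)
Lemma tderivP :
  derivation_sending (\col_i tseries (fun j => u j i 0)) tderiv.
Proof.
split=> [c f g|f g|i].
- apply/tcoefP => e; rewrite tcoefD tcoefZ !tcoef_tderiv.
  under eq_bigr do rewrite tcoefD tcoefZ (derivationD (Dder _))
    (derivation_sum (Dder _)).
  rewrite big_split /=; congr (_ + _).
  under eq_bigr do under eq_bigr do rewrite (derivationZ (Dder _)).
  pose T (a b d : {cmonom 'I_1}) := c a *: D (tdeg b) (tcoef d f).
  rewrite -(factorsA (fun b a d => T a b d)).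
  under [RHS]eq_bigr do rewrite tcoef_tderiv scaler_sumr.
  rewrite -(factorsA T); apply: eq_bigr => p _.
  exact: factorsC.
- have DM j a b : D j (a * b) = D j a * b + a * D j b by case: (Dder j).
  apply/tcoefP => e; rewrite tcoefD !tcoefM tcoef_tderiv.
  under eq_bigr => p _ do rewrite tcoefM (derivation_sum (Dder _)).
  under eq_bigr do under eq_bigr do rewrite DM.
  under eq_bigr do rewrite big_split /=.
  rewrite big_split /=; congr (_ + _).
    rewrite -(factorsA (fun a b d => D (tdeg a) (tcoef b f) * tcoef d g)).
    by under [RHS]eq_bigr do rewrite tcoef_tderiv mulr_suml.
  rewrite -(factorsA (fun a b d => tcoef b f * D (tdeg a) (tcoef d g))).
  under [RHS]eq_bigr do rewrite tcoef_tderiv mulr_sumr.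
  rewrite -(factorsA (fun b a d => tcoef b f * D (tdeg a) (tcoef d g))).
  by apply: eq_bigr => p _; exact: factorsC.
rewrite fps_var_const tderiv_const mxE; congr tseries.
by apply: boolp.funext => j; case: (Dder j).
Qed.
End Tderiv.

(** * The differential equation of the inverse map *)

Section InverseFlow.
Variables (K : comNzRingType) (n : nat) (M : varMonomType n).
Variables (u : nat -> 'cV[fps K M]_n) (D : nat -> fps K M -> fps K M).
Hypothesis Dder : forall j, derivation_sending (u j) (D j).
Variable H : 'cV[fps K M]_n.
Hypothesis u0 : u 0%N = H.
Hypothesis uS : forall j i, u j.+1 i 0 = D j (H i 0).
Variables (F G : {lrmorphism fps (tps K) M -> fps (tps K) M}).
Hypothesis Fvar : forall i,
  F (fps_var M i) = fps_var M i - tvar K *: fps_const_t (H i 0).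
Hypotheses (FK : cancel F G) (GK : cancel G F).

(** The recursion on the u_j says that \sum_j t^j u_j = H + t \sum_j t^j D_j H, so
that the terms in t cancel. *)
Lemma tderiv_Fvar i : tderiv D (F (fps_var M i)) = fps_const_t (H i 0).
Proof.
have P := tderivP Dder; have [_ _ /(_ i) Pz] := P.
rewrite Fvar -scaleNr (derivationD P) (derivationZ P) Pz mxE.
rewrite (tderiv_const Dder) scaleNr tseries_recl u0 -addrA.
rewrite (_ : (fun j => u j.+1 i 0) = (fun j => D j (H i 0))) ?subrr ?addr0 //.
exact: boolp.funext.
Qed.

Lemma dt_Fvar i : dt (F (fps_var M i)) = - fps_const_t (H i 0).
Proof.
apply: (addIr (dt (tvar K *: fps_const_t (H i 0)))).
rewrite -dtD Fvar subrK fps_var_const dt_const dt_tvar.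
by rewrite dt_const scaler0 addr0 addNr.
Qed.

(** The defect E of this identity satisfies the Leibniz rule with respect to G
rather than to the identity, so derivations enter only after composition with
F, which undoes G. The terms in which t itself is differentiated cancel
between the two occurrences of d/dt; this makes E linear over K[[t]]. *)
Lemma dt_inverse f : dt (G f) = G (dt f) + G (tderiv D f).
Proof.
pose E f := dt (G f) - (G (dt f) + G (tderiv D f)).
have P := tderivP Dder; have [Pl PM Pz] := P.
have swap (p q a b c d : fps (tps K) M) :
    p + q - (a + b + (c + d)) = p - (a + c) + (q - (b + d)).
  by rewrite [a + b + _]addrACA opprD addrACA.
suff EF : derivation_sending 0 (E \o F).
  have Z : derivation_sending 0 (fun _ : fps (tps K) M => 0).
    by split=> [c g h|g h|i]; rewrite ?mxE ?mulr0 ?mul0r ?scaler0 ?addr0.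
  have := derivation_sending_uniq EF Z (G f).
  by rewrite /= GK => /eqP; rewrite subr_eq0 => /eqP.
split=> [c g h|g h|i] /=.
- rewrite /E linearP !dtD !dtZ Pl -!addrA !linearP /= !FK dtD dtZ.
  rewrite -[_ + dt h]addrA -[_ *: g + _ + (_ + _)]addrA opprD addrACA subrr add0r.
  by rewrite swap scalerBr scalerDr.
- rewrite /E !rmorphM /= !FK !dtM PM !rmorphD !rmorphM /= !FK.
  by rewrite swap mulrBl mulrBr mulrDl mulrDr.
by rewrite /E FK fps_var_const dt_const -fps_var_const dt_Fvar tderiv_Fvar mxE
  -raddfD addNr raddf0 subrr.
Qed.

(** Modulo t the map G is an algebra endomorphism fixing the variables. It is the
identity by induction on the degree of the coefficient: peeling one variable off
a series strictly lowers the degree that has to be known in the cofactor. *)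
Lemma tcoef0_inverse f :
  (forall i, exists g, G (fps_var M i) = fps_var M i + tvar K *: g) ->
  tcoef (tmon 0) (G f) = tcoef (tmon 0) f.
Proof.
move=> Gz; apply/fpsP => w; have [k] := ubnP (tdeg w).
elim: k w f => // k IH w f wk.
have [g ->] := fps_head_split f.
have -> : G ((f (@mone M))%:A + \sum_i fps_var M i * g i) =
    (f (@mone M))%:A + \sum_i G (fps_var M i) * G (g i).
  rewrite linearP rmorph1 raddf_sum; congr (_ + _).
  by apply: eq_bigr => i _; exact: rmorphM.
rewrite !tcoefD !fpsDE; congr (_ + _).
rewrite !tcoef_sum !fps_sumE; apply: eq_bigr => i _.
have [g' Gi] := Gz i; rewrite !tcoef0M Gi tcoefD tcoef0_tvar addr0.
rewrite fps_var_const tcoef_const eqxx scale1r !fpsME.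
rewrite big_seq [RHS]big_seq; apply: eq_bigr => p; rewrite mem_factors => /eqP pw.
rewrite [fps_var M i p.1]/=; case: eqP => [p1|_]; last by rewrite !mul0r.
by rewrite IH //; move: wk; rewrite -pw p1 tdegM tdeg_var add1n ltnS.
Qed.

(** Linearity over K[[t]] suffices to apply G termwise to an infinite sum, as
the coefficient of t^m does not see multiples of t^(m+1). *)
Lemma tcoef_G_tseries m a : tcoef (tmon m) (G (tseries a)) =
  \sum_(j < m.+1) tcoef (tmon (m - j)) (G (fps_const_t (a j))).
Proof.
elim: m a => [|m IH] a; rewrite tseries_recl addrC linearP /= tcoefD.
  by rewrite tcoef0_tvar add0r big_ord1.
by rewrite tcoefS_tvar IH addrC [RHS]big_ord_recl subn0.
Qed.

(** The coefficient of t^m in the differential equation [dt_inverse]. *)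
Lemma inverse_recurrence m h :
  tcoef (tmon m.+1) (G (fps_const_t h)) *+ m.+1 =
  \sum_(j < m.+1) tcoef (tmon (m - j)) (G (fps_const_t (D j h))).
Proof.
rewrite -tcoef_dt dt_inverse dt_const raddf0 add0r.
by rewrite (tderiv_const Dder) tcoef_G_tseries.
Qed.
End InverseFlow.

(** * Recurrences and sums over compositions *)

(** The empty sequence is admitted for m = 0, so that the remainder left by
detaching the last part of a composition needs no case distinction. *)
Definition compositions0 (m : nat) : seq (seq nat) :=
  if m is 0 then [:: [::]] else compositions m.

Lemma mem_compositions0 m I :
  (I \in compositions0 m) = all (fun i => 0 < i)%N I && (sumn I == m).
Proof.
case: m => [|m].
  by case: I => [|[|i] I]; rewrite ?inE //= addSn andbF.
by rewrite mem_compositions; case: I.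
Qed.

Lemma compositions0_uniq m : uniq (compositions0 m).
Proof. by case: m => // m; exact: compositions_uniq. Qed.

Lemma big_compositions_rcons (V : nmodType) m (f : seq nat -> V) :
  \sum_(I <- compositions m.+1) f I =
  \sum_(j < m.+1) \sum_(J <- compositions0 (m - j)) f (rcons J j.+1).
Proof.
rewrite -(big_mkord xpredT
  (fun j => \sum_(J <- compositions0 (m - j)) f (rcons J j.+1))).
rewrite -(big_allpairs_dep (h := fun j J => rcons J j.+1)
  (r1 := index_iota 0 m.+1) (r2 := fun j => compositions0 (m - j))).
apply: perm_big; apply: uniq_perm; first exact: compositions_uniq.
  apply: allpairs_uniq_dep => [|j _|]; rewrite ?iota_uniq ?compositions0_uniq //.
  move=> [j J] [k L] _ _ /= /eqP; rewrite eqseq_rcons eqSS.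
  by move=> /andP[/eqP -> /eqP ->].
move=> I; rewrite -[compositions m.+1]/(compositions0 m.+1) mem_compositions0.
apply/andP/allpairsPdep => [[Ipos Im]|[j [J [jm JC ->]]]].
  case/lastP: I => [|J [|j]] // in Ipos Im *; first by rewrite all_rcons in Ipos.
  move: Ipos Im; rewrite all_rcons sumn_rcons addnS eqSS => /= Jpos /eqP Jm.
  exists j, J; rewrite mem_compositions0 Jpos -Jm addnK eqxx mem_index_iota.
  by rewrite /= ltnS leq_addl.
move: jm JC; rewrite mem_index_iota ltnS mem_compositions0 /=.
move=> jm /andP[Jpos /eqP Jm].
by rewrite all_rcons sumn_rcons Jm addnS subnK ?eqxx.
Qed.

Lemma pi_u_rcons J k : pi_u (rcons J k) = (pi_u J * (sumn J + k))%N.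
Proof.
rewrite /pi_u size_rcons big_ord_recr /= -(size_rcons J k) take_size sumn_rcons.
congr (_ * _)%N; apply: eq_bigr => j _.
by rewrite -cats1 takel_cat.
Qed.

Section CompositionSum.
Variables (K : comAlgType rat) (V : lmodType K).
Variables (psi : nat -> V -> V) (A : nat -> V -> V).
Hypothesis A0 : forall f, A 0%N f = f.
Hypothesis AS : forall m f,
  A m.+1 f *+ m.+1 = \sum_(j < m.+1) A (m - j)%N (psi j.+1 f).

(** The recurrence applies first the operator indexed by the last part, as psi^I
does, and each step divides by the size of the composition built so far; the
product of these sizes is pi_u. *)
Lemma recurrence_compositions m f :
  A m f = \sum_(I <- compositions0 m)
    ((pi_u I)%:R^-1 : rat)%:A *: psi_comp psi I f.
Proof.
have [k] := ubnP m; elim: k m f => // k IH [|m] f mk.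
  by rewrite big_seq1 A0 /pi_u big_ord0 invr1 !scale1r.
transitivity ((m.+1%:R^-1 : rat)%:A *: (A m.+1 f *+ m.+1)).
  have mA : m.+1%:R = (m.+1%:R : rat)%:A :> K by rewrite scaler_nat.
  rewrite -[A m.+1 f *+ m.+1]scaler_nat scalerA mulr_algl mA scalerA.
  by rewrite mulVf ?Num.Theory.pnatr_eq0 // !scale1r.
rewrite AS scaler_sumr big_compositions_rcons; apply: eq_bigr => j _.
rewrite IH ?(leq_ltn_trans (leq_subr _ _)) // scaler_sumr.
rewrite big_seq [RHS]big_seq; apply: eq_bigr => J.
rewrite mem_compositions0 => /andP[_ /eqP Jm].
rewrite pi_u_rcons Jm addnS subnK -1?ltnS // natrM invfM.
by rewrite scalerA mulr_algl scalerA mulrC /psi_comp foldr_rcons.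
Qed.
End CompositionSum.

(** * The inversion formula *)

Section InverseFormula.
Variables (K : comAlgType rat) (n : nat) (M : varMonomType n).
Variable deriv : 'cV[fps K M]_n -> fps K M -> fps K M.
Hypothesis derivP : forall u, derivation_sending u (deriv u).

(** Words and exponent vectors are treated at once through their common interface;
of the operators [u d/dz] only their characterization as derivations enters. *)
Lemma inverse_formula (alpha : nat) (H : 'cV[fps K M]_n)
    (F : {lrmorphism fps (tps K) M -> fps (tps K) M})
    (G : fps (tps K) M -> fps (tps K) M)
    (Nt : 'cV[fps (tps K) M]_n) (N : nat -> 'cV[fps K M]_n) :
  Et alpha H F -> cancel F G -> cancel G F ->
  (forall i, G (fps_var _ i) = fps_var _ i + tvar K *: Nt i 0) ->
  (forall i, Nt i 0 = tseries (fun k => N k.+1 i 0)) ->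
  forall (m : nat) (i : 'I_n), (1 <= m)%N ->
    N m i 0 = \sum_(I <- compositions m)
      ((pi_u I)%:R^-1 : rat)%:A *:
        psi_comp (fun k => deriv (Cseq deriv H k)) I (fps_var _ i).
Proof.
move=> [_ _ Fz] FK GK Gz NtE [//|m] i _.
pose GLin := GRing.isLinear.Build _ _ _ _ G (can2_linear FK GK).
pose GMon := GRing.isMonoidMorphism.Build _ _ G (can2_monoid_morphism FK GK).
pose G' : {lrmorphism fps (tps K) M -> fps (tps K) M} :=
  HB.pack G GLin GMon.
pose D j := deriv (Cseq deriv H j.+1).
have Dder j : derivation_sending (Cseq deriv H j.+1) (D j) by exact: derivP.
have CS j k : Cseq deriv H j.+2 k 0 = D j (H k 0) by rewrite /D /= mxE.
pose A m f := tcoef (tmon m) (G (fps_const_t f)).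
have AS k f : A k.+1 f *+ k.+1 = \sum_(j < k.+1) A (k - j)%N (D j f).
  exact: (@inverse_recurrence _ _ _ _ _ Dder H erefl CS F G' Fz FK GK).
have A0 f : A 0%N f = f.
  rewrite /A (@tcoef0_inverse _ _ _ G') => [|k]; last by exists (Nt k 0); exact: Gz.
  by rewrite tcoef_const eqxx scale1r.
rewrite -(@recurrence_compositions K (fps K M) (fun k => deriv (Cseq deriv H k))
  A A0 AS m.+1).
rewrite /A -fps_var_const Gz tcoefD tcoefS_tvar NtE tcoef_tseries tdeg_tmon.
rewrite fps_var_const tcoef_const [_ == _]negbTE ?scale0r ?add0r //.
by apply/eqP => /(congr1 (@tdeg 1 _)); rewrite tdeg_tmon tdeg1.
Qed.
End InverseFormula.

(** By the chain rule, [C d/dz] H is the product of the Jacobian matrix of H with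
the column C once the variables commute. *)
Lemma Cseq_jacobian (R : comNzRingType) n (H : 'cV[cfps R n]_n) k :
  Cseq (@cderiv R n) H k = jacobian H ^+ k.-1 *m H.
Proof.
rewrite /Cseq; elim: k.-1 => [|m IH]; first by rewrite expr0 mul1mx.
rewrite iterS IH exprS -mulmxE -mulmxA; apply/matrixP => i j.
rewrite !mxE ord1; apply: eq_bigr => k' _.
by rewrite !mxE mulrC.
Qed.

Theorem proposition5p6 (K : comAlgType rat) (n alpha : nat) (halpha : (1 <= alpha)%N) :
  (forall (H : 'cV[ncfps K n]_n)
     (F : {lrmorphism ncfps (tps K) n -> ncfps (tps K) n})
     (G : ncfps (tps K) n -> ncfps (tps K) n)
     (Nt : 'cV[ncfps (tps K) n]_n) (N : nat -> 'cV[ncfps K n]_n),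
     Et alpha H F -> cancel F G -> cancel G F ->
     (forall i, G (fps_var _ i) = fps_var _ i + tvar K *: Nt i 0) ->
     (forall i, Nt i 0 = tseries (fun k => N k.+1 i 0)) ->
   forall (m : nat) (i : 'I_n), (1 <= m)%N ->
     N m i 0 = \sum_(I <- compositions m)
       ((pi_u I)%:R^-1 : rat)%:A *:
         psi_comp (fun k => ncderiv (Cseq (@ncderiv K n) H k)) I (fps_var _ i))
  /\
  (forall (H : 'cV[cfps K n]_n)
     (F : {lrmorphism cfps (tps K) n -> cfps (tps K) n})
     (G : cfps (tps K) n -> cfps (tps K) n)
     (Nt : 'cV[cfps (tps K) n]_n) (N : nat -> 'cV[cfps K n]_n),
     Et alpha H F -> cancel F G -> cancel G F ->
     (forall i, G (fps_var _ i) = fps_var _ i + tvar K *: Nt i 0) ->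
     (forall i, Nt i 0 = tseries (fun k => N k.+1 i 0)) ->
   forall (m : nat) (i : 'I_n), (1 <= m)%N ->
     N m i 0 = \sum_(I <- compositions m)
       ((pi_u I)%:R^-1 : rat)%:A *:
         psi_comp (fun k => cderiv (Cseq (@cderiv K n) H k)) I (fps_var _ i)
     /\
     N m i 0 = \sum_(I <- compositions m)
       ((pi_u I)%:R^-1 : rat)%:A *:
         psi_comp (fun k => cderiv (jacobian H ^+ k.-1 *m H)) I (fps_var _ i)).

Proof.
split=> H F G Nt N EtF FK GK Gz NtE m i m0.
  exact: (inverse_formula (@ncderivP K n) EtF FK GK Gz NtE).
have NE := inverse_formula (@cderivP K n) EtF FK GK Gz NtE i m0.
split; first exact: NE.
rewrite NE; apply: eq_bigr => I _; congr (_ *: _).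
by elim: I => //= k I ->; rewrite Cseq_jacobian.
Qed.
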